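(* Let $\Omega\subset\mathbb{R}^N$ ($N\geq1$) be an open and bounded $BV$ extension domain, and let $u\in\mathcal{R}_\infty(\Omega)$ and $\varepsilon_0>0$. Then $$\lim_{\varepsilon\downarrow\varepsilon_0}\,(\varepsilon,\infty)\text{-}\mathrm{Var}\,u=(\varepsilon_0,\infty)\text{-}\mathrm{Var}\,u.$$
   Context: Functions are real-valued and elements of $L^1(\Omega)$ are identified when they agree Lebesgue-almost everywhere; $\|\cdot\|_1$ and $\|\cdot\|_\infty$ are the $L^1(\Omega)$- and $L^\infty(\Omega)$-norms. When $N=1$, $\Omega$ is assumed to be an interval. Variation: for $u\in L^1(\Omega)$, $\mathrm{Var}\,u:=\sup\{\int_\Omega u\,\mathrm{div}\,\varphi\,dx \mid \varphi\in[C_c^1(\Omega)]^N,\ \|\varphi\|_\infty\le 1\}\in[0,\infty]$, and $BV(\Omega):=\{u\in L^1(\Omega)\mid \mathrm{Var}\,u<\infty\}$, a Banach space with norm $\|u\|_{BV}=\|u\|_1+\mathrm{Var}\,u$. $BV$ extension domain (Ambrosio–Fusco–Pallara, Definition 3.20): an open set $\Omega\subset\mathbb{R}^N$ with bounded boundary such that for every open set $A\supset\overline{\Omega}$ and every $m\ge1$ there is a linear continuous extension operator $T:[BV(\Omega)]^m\to[BV(\mathbb{R}^N)]^m$ (so $Tu=u$ a.e. in $\Omega$) with: $Tu=0$ a.e. in $\mathbb{R}^N\setminus A$ for all $u\in[BV(\Omega)]^m$; $|D(Tu)|(\partial\Omega)=0$ for all $u\in[BV(\Omega)]^m$; and for every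 $q\in[1,\infty]$ the restriction of $T$ to $[W^{1,q}(\Omega)]^m$ is a linear continuous map into $[W^{1,q}(\mathbb{R}^N)]^m$. $(\varepsilon,\infty)$-variation: for $u\in L^1(\Omega)$ and $\varepsilon>0$, $(\varepsilon,\infty)\text{-}\mathrm{Var}\,u:=\inf\{\mathrm{Var}\,v\mid v\in BV(\Omega),\ \|u-v\|_\infty\le\varepsilon\}$, with the convention that the infimum over the empty set is $\infty$. $\infty$-regulated functions: $\mathcal{R}_\infty(\Omega):=\{u\in L^1(\Omega)\mid (\varepsilon,\infty)\text{-}\mathrm{Var}\,u<\infty\text{ for every }\varepsilon>0\}$. *)

(* Defs.v *)
From HB Require Import structures.
From mathcomp Require Import all_boot all_order all_algebra.
From mathcomp Require Import all_classical all_reals all_analysis.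

Set Implicit Arguments.
Unset Strict Implicit.
Unset Printing Implicit Defensive.

Import Order.TTheory GRing.Theory Num.Theory.
Import numFieldNormedType.Exports.

Local Open Scope classical_set_scope.
Local Open Scope ring_scope.

(* R^N is 'rV[R]_N, whose library norm is the max norm: it gives the usual
   topology and bounded sets; the Euclidean norm is [enorm] below. *)

Fact rV_display : measure_display. Proof. exact: default_measure_display. Qed.

Section rV_measurable.
Variables (R : realType) (N : nat).

Let coord (i : 'I_N) (x : 'rV[R]_N) : R := x ord0 i.

Let rV_set0 : g_sigma_preimage coord set0.
Proof. exact: sigma_algebra0. Qed.

Let rV_setC A : g_sigma_preimage coord A -> g_sigma_preimage coord (~` A).
Proof. exact: sigma_algebraC. Qed.

Let rV_bigcup (F : (set 'rV[R]_N)^nat) :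
  (forall i, g_sigma_preimage coord (F i)) ->
  g_sigma_preimage coord (\bigcup_i (F i)).
Proof. exact: sigma_algebra_bigcup. Qed.

(* generated by the coordinate maps; on R^N this is the Borel sigma-algebra *)
HB.instance Definition _ := @isMeasurable.Build rV_display 'rV[R]_N
  (g_sigma_preimage coord) rV_set0 rV_setC rV_bigcup.

End rV_measurable.

Section rV_measurable_fun.
Variables (R : realType) (N : nat).

Lemma measurable_coord (i : 'I_N) :
  measurable_fun [set: 'rV[R]_N] (fun x : 'rV[R]_N => x ord0 i).
Proof.
move=> _ Y mY; rewrite setTI; apply: sub_sigma_algebra => /=.
rewrite -bigcup_seq/=; exists i => /=; first by rewrite mem_index_enum.
by exists Y => //; rewrite setTI.
Qed.

Lemma measurable_fun_rV d (T : measurableType d) (f : T -> 'rV[R]_N) :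
  (forall i, measurable_fun [set: T] (fun x => f x ord0 i)) ->
  measurable_fun [set: T] f.
Proof.
move=> mf.
have H : <<s \big[setU/set0]_(i < N) preimage_set_system setT
    (fun x : 'rV[R]_N => x ord0 i) measurable >> `<=`
    image_set_system setT f measurable.
  apply: smallest_sub.
    exact: sigma_algebra_image (sigma_algebra_measurable _).
  rewrite -bigcup_seq; apply: bigcup_sub => i _ A [B mB <-] /=.
  by rewrite /image_set_system/= !setTI; have := mf i measurableT B mB; rewrite setTI.
by move=> _ A mA; exact: H.
Qed.

End rV_measurable_fun.

Section cons_rV.
Variables (R : realType) (N : nat).

Definition cons_rV (p : measurableTypeR R * 'rV[R]_N) : 'rV[R]_N.+1 :=
  \row_i oapp (fun j => p.2 ord0 j) p.1 (unlift ord0 i).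

Definition uncons_rV (v : 'rV[R]_N.+1) : measurableTypeR R * 'rV[R]_N :=
  (v ord0 ord0, \row_j v ord0 (lift ord0 j)).

Lemma cons_rVK : cancel cons_rV uncons_rV.
Proof.
move=> [x v]; rewrite /uncons_rV /cons_rV mxE unlift_none/=; congr pair.
by apply/rowP => j; rewrite !mxE liftK.
Qed.

Lemma measurable_cons_rV : measurable_fun [set: _] cons_rV.
Proof.
apply: measurable_fun_rV => i.
case: (unliftP ord0 i) => [j ->|->].
  rewrite (_ : (fun _ => _) = (fun v : 'rV[R]_N => v ord0 j) \o snd).
    apply: (measurableT_comp (measurable_coord j)); exact: measurable_snd.
  by apply/funext => p/=; rewrite mxE liftK.
rewrite (_ : (fun _ => _) = (fst : measurableTypeR R * 'rV[R]_N -> R)).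
  exact: measurable_fst.
by apply/funext => p/=; rewrite mxE unlift_none.
Qed.

Lemma measurable_uncons_rV : measurable_fun [set: _] uncons_rV.
Proof.
apply/measurable_fun_pairP; split => /=.
  exact: measurable_coord.
apply: measurable_fun_rV => j.
rewrite (_ : (fun _ => _) = (fun v : 'rV[R]_N.+1 => v ord0 (lift ord0 j))).
  exact: measurable_coord.
by apply/funext => v/=; rewrite mxE.
Qed.

End cons_rV.

Section lebesgue_rV.
Variable R : realType.

Section step.
Variables (N : nat) (m : {sigma_finite_measure set 'rV[R]_N -> \bar R}).
Local Open Scope ereal_scope.

Definition lebesgue_step : set 'rV[R]_N.+1 -> \bar R :=
  pushforward (@lebesgue_measure R \x m) (@cons_rV R N).

Let mu : {measure set 'rV[R]_N.+1 -> \bar R} :=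
  measure_function_pushforward__canonical__measure_function_Measure
    (@lebesgue_measure R \x m) (@measurable_cons_rV R N).

HB.instance Definition _ := Measure.copy lebesgue_step mu.

Let sigma_finite_step : sigma_finite setT lebesgue_step.
Proof.
have /sigma_finiteP[F [TF ndF Foo]] := sigma_finiteT (@lebesgue_measure R).
have /sigma_finiteP[G [TG ndG Goo]] := sigma_finiteT m.
exists (fun k => @uncons_rV R N @^-1` (F k `*` G k)).
  apply/esym; rewrite -subTset => v _.
  have [k _ Fk] : (\bigcup_k F k) (uncons_rV v).1 by rewrite -TF.
  have [l _ Gl] : (\bigcup_k G k) (uncons_rV v).2 by rewrite -TG.
  exists (maxn k l) => //; split.
  - by move: Fk; exact/subsetPset/ndF/leq_maxl.
  - by move: Gl; exact/subsetPset/ndG/leq_maxr.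
move=> k; have [mF Fk] := Foo k; have [mG Gk] := Goo k; split.
  rewrite -[X in measurable X]setTI; apply: measurable_uncons_rV => //.
  exact: measurableX.
rewrite /lebesgue_step /pushforward -comp_preimage.
rewrite (_ : _ \o _ = id) ?preimage_id; last first.
  by apply/funext => p; exact: cons_rVK.
by rewrite product_measure1E// lte_mul_pinfty// ge0_fin_numE.
Qed.

HB.instance Definition _ :=
  @Measure_isSigmaFinite.Build _ _ _ lebesgue_step sigma_finite_step.

End step.

(* N-fold product of the one-dimensional Lebesgue measure; it is characterized
   by [lebesgue_rV_box] *)
Fixpoint lebesgue_rV (N : nat) :
    {sigma_finite_measure set 'rV[R]_N -> \bar R} :=
  if N is N'.+1 then lebesgue_step (lebesgue_rV N')
  else @dirac _ 'rV[R]_0 0 R.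

Lemma measurable_box (N : nat) (a b : 'rV[R]_N) :
  measurable [set x : 'rV[R]_N | forall i, a ord0 i <= x ord0 i <= b ord0 i].
Proof.
rewrite (_ : mkset _ = \bigcap_(i in [set: 'I_N])
    ((fun x : 'rV[R]_N => x ord0 i) @^-1` `[a ord0 i, b ord0 i])).
  apply: fin_bigcap_measurable => // i _; rewrite -[X in measurable X]setTI.
  by apply: measurable_coord => //; exact: measurable_itv.
apply/seteqP; split => x /=; first by move=> xab i _ /=; rewrite in_itv/=.
by move=> xab i; have := xab i I; rewrite /= in_itv.
Qed.

Lemma lebesgue_rV_box (N : nat) (a b : 'rV[R]_N) :
  (forall i, a ord0 i <= b ord0 i) ->
  lebesgue_rV N [set x | forall i, a ord0 i <= x ord0 i <= b ord0 i] =
  (\prod_i (b ord0 i - a ord0 i))%:E.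
Proof.
elim: N a b => [|N IH] a b ab.
  by rewrite big_ord0 /= diracE mem_set// => -[].
rewrite big_ord_recl /= /lebesgue_step /pushforward.
pose a' : 'rV[R]_N := \row_j a ord0 (lift ord0 j).
pose b' : 'rV[R]_N := \row_j b ord0 (lift ord0 j).
rewrite (_ : _ @^-1` _ = `[a ord0 ord0, b ord0 ord0]%classic `*`
    [set x : 'rV[R]_N | forall i, a' ord0 i <= x ord0 i <= b' ord0 i]).
  rewrite product_measure1E/=; last 2 first.
  - exact: measurable_itv.
  - exact: measurable_box.
  rewrite IH; last by move=> i; rewrite !mxE.
  rewrite lebesgue_measure_itv/= lte_fin EFinM -EFinB.
  under eq_bigr do rewrite !mxE.
  have [//|ba] := ltP; congr (_ * _)%E.
  by congr EFin; apply/esym/eqP; rewrite subr_eq0 eq_le ba ab.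
apply/seteqP; split => -[x v] /=.
  move=> H; split.
    by have := H ord0; rewrite mxE unlift_none/= in_itv.
  by move=> j; have := H (lift ord0 j); rewrite !mxE liftK.
move=> [xab H] i; rewrite mxE; case: (unliftP ord0 i) => [j ->|->] /=.
  by have := H j; rewrite !mxE.
by move: xab; rewrite in_itv.
Qed.

End lebesgue_rV.

Section test_functions.
Variables (R : realType) (N : nat).
Local Notation V := 'rV[R]_N.

Definition partial (i : 'I_N) (f : V -> R) : V -> R :=
  'D_(delta_mx ord0 i : V) f.

Fixpoint Ck (k : nat) (f : V -> R) : Prop :=
  if k is k'.+1 then
    continuous f /\
    forall i, (forall x, derivable f x (delta_mx ord0 i : V)) /\
              Ck k' (partial i f)
  else continuous f.

Definition enorm (v : V) : R := Num.sqrt (\sum_i v ord0 i ^+ 2).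

Definition supp (W : zmodType) (f : V -> W) : set V :=
  closure [set x | f x != 0].

(* functions compactly supported in Omega are extended by 0 to R^N *)
Definition compactly_supported (Omega : set V) (W : zmodType) (f : V -> W) :=
  compact (supp f) /\ supp f `<=` Omega.

Definition C1c_field (Omega : set V) (phi : V -> V) : Prop :=
  (forall i, Ck 1 (fun x => phi x ord0 i)) /\ compactly_supported Omega phi.

Definition Cooc (Omega : set V) (psi : V -> R) : Prop :=
  (forall k, Ck k psi) /\ compactly_supported Omega psi.

Definition divergence (phi : V -> V) (x : V) : R :=
  \sum_i partial i (fun y => phi y ord0 i) x.

End test_functions.

(* A function on Omega is represented by a total function on R^N of which only
   the restriction to Omega matters; elements of L^q are not quotiented, all
   notions below being invariant under a.e. equality on Omega. *)

Section function_spaces.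
Variables (R : realType) (N : nat).
Local Notation V := 'rV[R]_N.
Local Notation leb := (lebesgue_rV R N).
Local Open Scope ereal_scope.
Implicit Types (Omega : set V) (u v : V -> R) (q : \bar R).

Definition Lqnorm Omega q u : \bar R := Lnorm leb q ((EFin \o u) \_ Omega).

Definition Lq Omega q u : Prop :=
  measurable_fun Omega u /\ Lqnorm Omega q u < +oo.

Definition L1 Omega u : Prop := leb.-integrable Omega (EFin \o u).

(* phi being continuous and 0 off Omega, its sup norm over Omega is the supremum
   of its Euclidean norm over R^N *)
Definition Var Omega u : \bar R :=
  ereal_sup [set \int[leb]_(x in Omega) (u x * divergence phi x)%:E |
             phi in [set phi | C1c_field Omega phi /\
                               forall x, (enorm (phi x) <= 1)%R]].

Definition BV Omega u : Prop := L1 Omega u /\ Var Omega u < +oo.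

Definition BVnorm Omega u : \bar R := Lqnorm Omega 1 u + Var Omega u.

Definition weak_gradient Omega u (g : 'I_N -> V -> R) : Prop :=
  forall i psi, Cooc Omega psi ->
    \int[leb]_(x in Omega) (u x * partial i psi x)%:E =
    - \int[leb]_(x in Omega) (g i x * psi x)%:E.

Definition W1q_gradient Omega q u (g : 'I_N -> V -> R) : Prop :=
  weak_gradient Omega u g /\ forall i, Lq Omega q (g i).

Definition W1q Omega q u : Prop :=
  Lq Omega q u /\ exists g, W1q_gradient Omega q u g.

(* the weak gradient is unique a.e., so this is the infimum of one value *)
Definition W1qnorm Omega q u : \bar R :=
  ereal_inf [set Lqnorm Omega q u + \sum_i Lqnorm Omega q (g i) |
             g in W1q_gradient Omega q u].

End function_spaces.

Section derivative_measure.
Variables (R : realType) (N : nat).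
Local Notation V := 'rV[R]_N.
Local Notation leb := (lebesgue_rV R N).
Local Open Scope ereal_scope.

(* integral with respect to a signed measure; it does not depend on the
   Hahn decomposition, which is chosen *)
Definition charge_integral (nu : {charge set V -> \bar R}) (f : V -> R) :
    \bar R :=
  let hahn := projT2 (cid (projT2 (cid (Hahn_decomposition nu)))) in
  \int[jordan_pos hahn]_x (f x)%:E - \int[jordan_neg hahn]_x (f x)%:E.

(* the matrix-valued finite measure mu is the distributional derivative Dv *)
Definition derivative_measure (m : nat) (v : 'I_m -> V -> R)
    (mu : 'I_m -> 'I_N -> {charge set V -> \bar R}) : Prop :=
  forall j i psi, Cooc [set: V] psi ->
    \int[leb]_x (v j x * partial i psi x)%:E = - charge_integral (mu j i) psi.

(* |mu|(B): supremum over countable Borel partitions of B, entries of mu being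
   measured in Frobenius norm *)
Definition mx_total_variation (m : nat)
    (mu : 'I_m -> 'I_N -> {charge set V -> \bar R}) (B : set V) : \bar R :=
  ereal_sup
    [set \sum_(0 <= h <oo)
       (Num.sqrt (\sum_j \sum_i fine (mu j i (E h)) ^+ 2)%R)%:E |
     E in [set E : nat -> set V | [/\ forall h, measurable (E h),
                                      trivIset setT E & \bigcup_h E h = B]]].

End derivative_measure.

Section extension.
Variables (R : realType) (N : nat).
Local Notation V := 'rV[R]_N.
Local Notation leb := (lebesgue_rV R N).
Local Open Scope ereal_scope.
Implicit Types (Omega A : set V) (q : \bar R).

Definition boundary Omega : set V := closure Omega `\` Omega°.

Section vector.
Variable m : nat.
Local Notation fields := ('I_m -> V -> R).
Implicit Types (u : fields) (T : fields -> fields).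

Definition BVm Omega u : Prop := forall j, BV Omega (u j).

Definition W1qm Omega q u : Prop := forall j, W1q Omega q (u j).

(* [T] acts on a.e.-classes: by [linear_on] and [bounded_on], it sends functions
   that agree a.e. on Omega to functions that agree a.e. *)
Definition linear_on (D : set fields) T : Prop :=
  forall (a b : R) u v, D u -> D v -> forall j,
    {ae leb, forall x, T (fun k y => a * u k y + b * v k y)%R j x =
                       (a * T u j x + b * T v j x)%R}.

(* continuity of a linear operator; product spaces carry the sum norm *)
Definition bounded_on (D : set fields) (n1 n2 : (V -> R) -> \bar R) T : Prop :=
  exists C : R, forall u, D u ->
    \sum_j n2 (T u j) <= C%:E * \sum_j n1 (u j).

(* As [T] acts on [BV(Omega)]^m, its restriction to Sobolev functions is its
   restriction to those that are in [BV(Omega)]^m, which is no condition when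
   Omega is bounded. Linearity there is inherited. *)
Definition BV_extension_operator Omega A T : Prop :=
  [/\ [/\ linear_on (BVm Omega) T,
          (forall u, BVm Omega u -> BVm [set: V] (T u)) &
          bounded_on (BVm Omega) (BVnorm Omega) (BVnorm [set: V]) T],
      (forall u j, BVm Omega u ->
         {ae leb, forall x, Omega x -> T u j x = u j x}),
      (forall u j, BVm Omega u ->
         {ae leb, forall x, ~ A x -> T u j x = 0%R}),
      (forall u, BVm Omega u ->
         exists mu, derivative_measure (T u) mu /\
                    mx_total_variation mu (boundary Omega) = 0) &
      forall q, 1 <= q ->
        let D := BVm Omega `&` W1qm Omega q in
        (forall u, D u -> W1qm [set: V] q (T u)) /\
        bounded_on D (W1qnorm Omega q) (W1qnorm [set: V] q) T].

End vector.

(* Ambrosio, Fusco, Pallara, Functions of bounded variation and free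
   discontinuity problems, Definition 3.20 *)
Definition BV_extension_domain Omega : Prop :=
  [/\ open Omega, bounded_set (boundary Omega) &
      forall A, open A -> closure Omega `<=` A ->
        forall m, (1 <= m)%N ->
          exists T, @BV_extension_operator m Omega A T].

End extension.

Section regulated.
Variables (R : realType) (N : nat).
Local Notation V := 'rV[R]_N.
Local Open Scope ereal_scope.
Implicit Types (Omega : set V) (u : V -> R) (eps : R).

(* [ereal_inf set0 = +oo] *)
Definition eps_Var Omega eps u : \bar R :=
  ereal_inf [set Var Omega v |
             v in [set v | BV Omega v /\
                           Lqnorm Omega +oo (u \- v)%R <= eps%:E]].

Definition regulated_oo Omega u : Prop :=
  L1 Omega u /\ forall eps, (0 < eps)%R -> eps_Var Omega eps u < +oo.

End regulated.

(* Main.v *)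
Require Import Defs.
From mathcomp Require Import all_boot all_order all_algebra.
From mathcomp Require Import all_classical all_reals all_analysis.
From mathcomp Require Import measurable_realfun ess_sup_inf hoelder.
From mathcomp Require Import ring lra.

(* The function eps |-> eps_Var eps u is nonincreasing, so its right limit at
   eps0 is the supremum L of its values beyond eps0, and it remains to find v
   with Var v <= L and |u - v| <= eps0. Compactness of BV is avoided by a
   convexity argument: the sets K_n of all w with |w| <= eps0 + 1/n and
   Var (u + w) <= L + 1/n are nonempty, convex, decreasing and bounded in
   L^2(Omega). By the parallelogram law, well-chosen almost minimizers of the
   L^2 norm over the K_n form a fast Cauchy sequence, hence converge almost
   everywhere, and by dominated convergence in the definition of Var the limit
   w gives v = u + w. *)

Set Implicit Arguments.
Unset Strict Implicit.
Unset Printing Implicit Defensive.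

Import Order.TTheory GRing.Theory Num.Theory.
Import numFieldNormedType.Exports.

Local Open Scope classical_set_scope.
Local Open Scope ring_scope.

(** * Almost everywhere convergence along nested convex sets of bounded functions *)

Section ae_convergence.
Context d (T : measurableType d) (R : realType).
Variables (mu : {measure set T -> \bar R}) (D : set T).
Hypotheses (mD : measurable D) (muD : (mu D < +oo)%E).
Implicit Types f g : T -> R.

Lemma ae_bounded_integrable f (C : R) : measurable_fun D f ->
  {ae mu, forall x, D x -> `|f x| <= C} -> mu.-integrable D (EFin \o f).
Proof.
move=> mf fC; apply/integrableP; split; first exact/measurable_EFinP.
have C0 : 0 <= `|C| by [].
apply: (@le_lt_trans _ _ (\int[mu]_(x in D) (cst `|C|%:E x))%E).
  apply: ae_ge0_le_integral => //.
  - by apply: measurableT_comp => //; exact/measurable_EFinP.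
  - by apply: filterS fC => x fC Dx; rewrite lee_fin (le_trans (fC Dx))// ler_norm.
rewrite integral_cst//; apply: lte_mul_pinfty => //.
Qed.

Lemma ae_bounded_integrable_sqr f (C : R) : measurable_fun D f ->
  {ae mu, forall x, D x -> `|f x| <= C} ->
  mu.-integrable D (EFin \o (fun x => f x ^+ 2)).
Proof.
move=> mf fC; apply: (@ae_bounded_integrable _ (C ^+ 2)).
  exact: measurable_funX.
apply: filterS fC => x fC /fC {}fC.
by rewrite normrX lerXn2r ?nnegrE// (le_trans _ fC).
Qed.

(** The bounds [c / 2 ^ k.+1] add up to [c], so the sum of all [|w k.+1 x - w k x|] is integrable
    and hence finite for almost every [x]; there the telescoping series converges absolutely. *)
Lemma ae_cvg_of_summable_increments (w : nat -> T -> R) (c : R) : 0 <= c ->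
  (forall k, measurable_fun D (w k)) ->
  (forall k, (\int[mu]_(x in D) `|w k.+1 x - w k x|%:E
              <= (c / (2 ^ k.+1)%:R)%:E)%E) ->
  {ae mu, forall x, D x -> cvgn (w ^~ x)}.
Proof.
move=> c0 mw wc.
pose f k x : \bar R := `|w k.+1 x - w k x|%:E.
have f0 k x : (0 <= f k x)%E by rewrite lee_fin.
have mf k : measurable_fun D (f k).
  apply/measurable_EFinP; apply: measurableT_comp => //.
  exact: measurable_funB.
have : mu.-integrable D (fun x => \sum_(k <oo) f k x)%E.
  apply/integrableP; split; first exact: ge0_emeasurable_sum.
  under eq_integral do rewrite gee0_abs ?nneseries_ge0//.
  rewrite integral_nneseries//.
  apply: le_lt_trans (ltry c).
  apply: le_trans (@epsilon_trick0 R c xpredT c0).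
  by apply: lee_nneseries => [k _ _|k _]; [exact: integral_ge0|exact: wc].
move=> /integrable_ae -/(_ mD); apply: filterS => x + Dx => /(_ Dx) fx.
have : cvgn (series (fun k => w k.+1 x - w k x)).
  apply: normed_cvg.
  apply: nnseries_is_cvg => [k|]; first exact: normr_ge0.
  by rewrite -ge0_fin_numE; [exact: fx|by apply: nneseries_ge0 => k _ _; exact: f0].
move=> cs.
have -> : w ^~ x = (fun n => w 0%N x + series (fun k => w k.+1 x - w k x) n).
  apply/funext => n; rewrite seriesEnat/= telescope_sumr//; ring.
exact: is_cvgD (is_cvg_cst _) cs.
Qed.

Let J f := \int[mu]_(x in D) (f x ^+ 2).

(** Parallelogram law, solved for the difference: a lower bound on [J] at the midpoint makes two
    almost minimizers close. The common bound [C] only makes the squares integrable. *)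
Let J_midpoint f g (C : R) :
  measurable_fun D f -> {ae mu, forall x, D x -> `|f x| <= C} ->
  measurable_fun D g -> {ae mu, forall x, D x -> `|g x| <= C} ->
  J (fun x => f x - g x) =
  2 * J f + 2 * J g - 4 * J (fun x => (f x + g x) / 2).
Proof.
move=> mf fC mg gC.
have iJf := ae_bounded_integrable_sqr mf fC.
have iJg := ae_bounded_integrable_sqr mg gC.
have mh : measurable_fun D (fun x => (f x + g x) / 2).
  by apply: measurable_funM => //; exact: measurable_funD.
have hC : {ae mu, forall x, D x -> `|(f x + g x) / 2| <= C}.
  apply: filterS2 fC gC => x fC gC Dx; move: (fC Dx) (gC Dx).
  by rewrite !ler_norml => /andP[? ?] /andP[? ?]; apply/andP; split; lra.
have iJh := ae_bounded_integrable_sqr mh hC.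
rewrite /J.
have iZ (a : R) h : mu.-integrable D (EFin \o h) ->
    mu.-integrable D (EFin \o (fun x => a * h x)).
  move=> ih.
  by apply: eq_integrable (integrableZl mD a ih) => // x _; rewrite /= EFinM.
rewrite -(RintegralZl 2 mD iJf) -(RintegralZl 2 mD iJg) -(RintegralZl 4 mD iJh).
have i2 := integrableD mD (iZ 2 _ iJf) (iZ 2 _ iJg).
rewrite -RintegralD//; [|exact: iZ|exact: iZ].
rewrite -RintegralB//; [|exact: iZ].
by apply: eq_Rintegral => x _; field.
Qed.

(** The midpoint of two almost minimizers of [J] stays in the larger of their sets, so its energy is
    nearly as large as theirs and the parallelogram law makes them close. The [K n] are not assumed
    closed, so [v] is not claimed to lie in them. *)
Lemma ae_cvg_of_nested_convex (K : nat -> set (T -> R)) (C : R) :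
  (forall n, K n !=set0) -> (forall n, K n.+1 `<=` K n) ->
  (forall n f g, K n f -> K n g -> K n (fun x => (f x + g x) / 2)) ->
  (forall f, K 0%N f ->
    measurable_fun D f /\ {ae mu, forall x, D x -> `|f x| <= C}) ->
  exists (w : nat -> T -> R) (v : T -> R),
    [/\ forall n, K n (w n), measurable_fun D v &
        {ae mu, forall x, D x -> w n x @[n --> \oo] --> v x}].
Proof.
move=> K0 Kdec Kmid KC.
have Kle m n : (m <= n)%N -> K n `<=` K m.
  move=> /subnK <-; elim: (n - m)%N => [//|k IH].
  by rewrite addSn; exact: subset_trans (Kdec _) IH.
have KKC n f : K n f -> measurable_fun D f /\
    {ae mu, forall x, D x -> `|f x| <= C}.
  by move=> /(Kle 0%N n (leq0n n)); exact: KC.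
have J0 f : 0 <= J f by apply: Rintegral_ge0 => x _; exact: sqr_ge0.
pose m := fine (mu D).
have m0 : 0 <= m by exact: fine_ge0.
have JC n f : K n f -> J f <= C ^+ 2 * m.
  move=> /KKC[mf fC].
  have := ae_bounded_integrable_sqr mf fC.
  move=> iJ.
  rewrite /J /Rintegral -lee_fin fineK; last exact: integrable_fin_num.
  rewrite EFinM /m fineK ?ge0_fin_numE// -integral_cst//.
  apply: ae_ge0_le_integral => //.
  - by move=> x _; rewrite lee_fin sqr_ge0.
  - exact: measurable_int iJ.
  - by move=> x _; rewrite lee_fin sqr_ge0.
  apply: filterS fC => x fC Dx; rewrite lee_fin -(real_normK (num_real (f x))).
  by rewrite lerXn2r ?nnegrE ?fC// (le_trans _ (fC Dx)).
(* The minimal energies increase, as the sets shrink, and are bounded by [C ^+ 2 * m]; hence they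
   have a finite supremum [s] and are eventually as close to it as desired. *)
pose e n := inf (J @` K n).
have hlb n : has_lbound (J @` K n) by exists 0 => _ [f _ <-].
have eJ n f : K n f -> e n <= J f by move=> Kf; apply: ge_inf => //; exists f.
have e_nd : {homo e : p q / (p <= q)%N >-> p <= q}.
  move=> p q pq; apply: lb_le_inf; first by have [f Kf] := K0 q; exists (J f), f.
  by move=> _ [f /(Kle _ _ pq) Kf <-]; exact: eJ.
have e_ub : has_ubound (range e).
  exists (C ^+ 2 * m) => _ [n _ <-]; have [f Kf] := K0 n.
  exact: le_trans (eJ _ _ Kf) (JC _ _ Kf).
pose s := sup (range e).
have es n : e n <= s by apply: ub_le_sup => //; exists n.
pose t k : R := (2 ^ k.+1)%:R.
have t0 k : 0 < t k by rewrite ltr0n expn_gt0.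
(* The tolerance is the inverse square of [t k]: multiplied by [t k] in the passage from L^2 to L^1,
   it still leaves the summable factor [1 / t k]. *)
pose dl k := (t k ^+ 2)^-1.
have dl0 k : 0 < dl k by rewrite invr_gt0 exprn_gt0.
have dlS k : dl k.+1 <= dl k.
  have tS : t k <= t k.+1 by rewrite ler_nat leq_exp2l.
  rewrite lef_pV2; [|by rewrite posrE exprn_gt0..].
  by rewrite lerXn2r ?nnegrE//; exact: ltW.
have rank k : {n | s - dl k < e n}.
  apply: cid; have [|_ [n _ <-] ?] := @sup_adherent R (range e) (dl k) (dl0 k).
    by split => //; exists (e 0%N), 0%N.
  by exists n.
(* The partial sums make [N] nondecreasing with [N k] at least [rank k]; the summand [k] ensures
   that [w k] lies in [K k]. *)
pose N k := (k + \sum_(i < k.+1) sval (rank i))%N.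
have NS k : (N k <= N k.+1)%N.
  by rewrite /N [in X in (_ <= X)%N]big_ord_recr/= leq_add// leq_addr.
have sN k : s - dl k < e (N k).
  apply: lt_le_trans (svalP (rank k)) _; apply: e_nd.
  by rewrite /N big_ord_recr/= addnA leq_addl.
have pick k : {f | K (N k) f /\ J f < e (N k) + dl k}.
  apply: cid; have [|_ [f Kf <-] ?] := @inf_adherent R (J @` K (N k)) _ (dl0 k).
    by split => //; have [f Kf] := K0 (N k); exists (J f), f.
  by exists f.
pose w k := sval (pick k).
have Kw k : K (N k) (w k) by have [] := svalP (pick k).
have Jw k : J (w k) < e (N k) + dl k by have [] := svalP (pick k).
have mw k : measurable_fun D (w k) by have [] := KKC _ _ (Kw k).
have wC k : {ae mu, forall x, D x -> `|w k x| <= C} by have [] := KKC _ _ (Kw k).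
(* The midpoint lies in [K (N k)], so its energy is at least [e (N k)], while
   [e (N k.+1) <= s < e (N k) + dl k]. The errors add up to at most [6 * dl k]. *)
have Jd k : J (fun x => w k.+1 x - w k x) <= 8 * dl k.
  rewrite (J_midpoint (mw _) (wC _) (mw _) (wC _)).
  have := eJ _ _ (Kmid _ _ _ (Kle _ _ (NS k) _ (Kw k.+1)) (Kw k)).
  have := Jw k; have := Jw k.+1; have := sN k; have := es (N k).
  have := es (N k.+1); have := dlS k.
  lra.
have cvgw : {ae mu, forall x, D x -> cvgn (w ^~ x)}.
  (* In the constant, 8 comes from [t k * (8 * dl k) = 8 / t k], and [m] from integrating the
     constant [1 / t k] over [D]. *)
  apply: (@ae_cvg_of_summable_increments w (8 + m)) => //; first by rewrite addr_ge0.
  move=> k; rewrite -/(t k).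
  have mdw : measurable_fun D (fun x => w k.+1 x - w k x).
    exact: measurable_funB.
  have dwC : {ae mu, forall x, D x -> `|w k.+1 x - w k x| <= C + C}.
    apply: filterS2 (wC k) (wC k.+1) => x h1 h2 Dx.
    by rewrite (le_trans (ler_normB _ _))// lerD ?h1 ?h2.
  have id2 := ae_bounded_integrable_sqr mdw dwC.
  have idw := ae_bounded_integrable mdw dwC.
  have -> : (\int[mu]_(x in D) `|w k.+1 x - w k x|%:E)%E =
      (\int[mu]_(x in D) `|w k.+1 x - w k x|)%:E.
    by rewrite /Rintegral fineK//; apply: integrable_fin_num => //;
      exact: integrable_norm idw.
  rewrite lee_fin.
  have ic : mu.-integrable D (EFin \o cst (t k)^-1).
    apply: (@ae_bounded_integrable _ (t k)^-1) => //.
    by apply: nearW => x _; rewrite ger0_norm// invr_ge0 ltW.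
  have itd : mu.-integrable D
      (EFin \o (fun x => t k * (w k.+1 x - w k x) ^+ 2)).
    by apply: eq_integrable (integrableZl mD (t k) id2) => // x _; rewrite /= EFinM.
  apply: (@le_trans _ _ (\int[mu]_(x in D)
      (t k * (w k.+1 x - w k x) ^+ 2 + (t k)^-1))).
    apply: le_Rintegral => //.
    - exact: integrable_norm idw.
    - by apply: eq_integrable (integrableD mD itd ic).
    move=> x _.
    (* a <= t a^2 + 1/t, from t (a - 1/t)^2 >= 0: the L^1 norm of an increment is
       controlled by its squared L^2 norm *)
    have tV : t k * (t k)^-1 = 1 by rewrite mulfV// gt_eqF.
    have tV0 : 0 < (t k)^-1 by rewrite invr_gt0.
    rewrite -(real_normK (num_real (w k.+1 x - w k x))).
    set a := `|_|; set b := (t k)^-1 in tV tV0 *.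
    have : 0 <= t k * (a - b) ^+ 2 by rewrite mulr_ge0 ?sqr_ge0 ?ltW.
    have -> : t k * (a - b) ^+ 2 =
      t k * a ^+ 2 - 2 * a * (t k * b) + b * (t k * b) by ring.
    have : 0 <= a by exact: normr_ge0.
    rewrite tV; lra.
  rewrite RintegralD// (RintegralZl _ mD id2) Rintegral_cst// -/m mulrDl.
  rewrite (mulrC m) lerD2r.
  have := Jd k; rewrite /J -(ler_pM2l (t0 k)) => /le_trans; apply.
  by rewrite /dl le_eqVlt; apply/orP; left; apply/eqP; field; rewrite gt_eqF.
(* The upper limit is measurable on all of [D], even where the sequence diverges, and equals the
   limit wherever that exists. *)
pose v x := fine (limn_esup (EFin \o (w ^~ x))).
exists w, v; split.
- move=> n; apply: Kle (Kw n); exact: leq_addr.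
- apply: measurableT_comp => //; apply: measurable_fun_limn_esup => n.
  exact/measurable_EFinP.
- apply: filterS cvgw => x + Dx => /(_ Dx) cw.
  have /cvg_ex[l wl] := cw.
  have El : (EFin \o w ^~ x) n @[n --> \oo] --> l%:E.
    exact: cvg_EFin (nearW _ _) _.
  by rewrite /v is_cvg_limn_esupE ?(cvg_lim _ El)//; apply/cvg_ex; exists l%:E.
Qed.

End ae_convergence.

(** * Open sets, bounded sets and the essential supremum norm in R^N *)

Section rV_borel.
Variables (R : realType) (N : nat).
Local Notation V := 'rV[R]_N.
Local Notation leb := (lebesgue_rV R N).
Implicit Types (Omega : set V) (f : V -> R).

(** The sigma-algebra is generated by the coordinates, so openness enters through boxes: an open set
    is the countable union of the cubes with rational center and radius that it contains. *)
Lemma open_measurable_rV Omega : open Omega -> measurable Omega.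
Proof.
move=> oO.
pose box (p : 'rV[rat]_N * rat) : set V :=
  [set x | forall i, (\row_j (ratr (p.1 ord0 j - p.2) : R)) ord0 i <= x ord0 i
                     <= (\row_j (ratr (p.1 ord0 j + p.2) : R)) ord0 i].
rewrite (_ : Omega = \bigcup_p (if `[< box p `<=` Omega >] then box p else set0)).
  apply: countable_bigcupT_measurable => //.
  by move=> p; case: ifP => // _; exact: measurable_box.
apply/seteqP; split => [x Ox|x [p _]]; last by case: asboolP => // + Bx; exact.
have /nbhs_ballP[e /= e0 eO] : nbhs x Omega by exact: open_nbhs_nbhs.
(* Two points of a cube of radius [r] differ by at most [2 * r] in each coordinate, which is below
   [e]. *)
have [r] : exists r, ratr r \in `]0, (e / 2)[ by apply: rat_in_itvoo; rewrite divr_gt0.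
rewrite in_itv/= => /andP[r0 re].
have /choice[q xq] i : exists q : rat, ratr q \in `](x ord0 i - ratr r), (x ord0 i + ratr r)[.
  by apply: rat_in_itvoo; lra.
have Bx : box (\row_i q i, r) x.
  move=> i; rewrite !mxE/= rmorphB rmorphD/=.
  by have := xq i; rewrite in_itv/= => /andP[? ?]; apply/andP; split; lra.
exists (\row_i q i, r) => //.
case: asboolP => // -[] y By; apply: eO; split=> // i j; rewrite ord1.
have := By j; have := Bx j; rewrite !mxE/= rmorphB rmorphD/=.
move=> /andP[? ?] /andP[? ?]; rewrite /ball/= ltr_norml; apply/andP; split; lra.
Qed.


Lemma continuous_measurable_rV f : continuous f -> measurable_fun setT f.
Proof.
move=> /continuousP cf; apply: (measurability _ (RGenOpens.measurableE R)).
move=> _ [_ [a [b ->] <-]]; rewrite setTI; apply: open_measurable_rV.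
by apply: cf; exact: interval_open.
Qed.

Lemma bounded_lebesgue_rV_lty Omega :
  measurable Omega -> bounded_set Omega -> (leb Omega < +oo)%E.
Proof.
move=> mO [M [_ OM]].
pose c := `|M| + 1.
have c0 : 0 <= c by rewrite addr_ge0.
have Oc x : Omega x -> `|x| <= c.
  by apply: OM; rewrite /c (le_lt_trans (ler_norm M))// ltrDl.
apply: le_lt_trans (ltry (\prod_(i < N) ((const_mx c : V) ord0 i -
  (const_mx (- c) : V) ord0 i))).
rewrite -lebesgue_rV_box; last by move=> i; rewrite !mxE; lra.
apply: le_measure; rewrite ?inE//; first exact: measurable_box.
move=> x /Oc xc i; rewrite !mxE -ler_norml (le_trans _ xc)//.
by rewrite [leRHS]/Num.norm/= mx_normrE; apply/bigmax_geP; right; exists (ord0, i).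
Qed.

(** [Omega] need not be closed, so compactness is applied to a closed ball that contains it. *)
Lemma continuous_bounded_rV Omega f : bounded_set Omega -> continuous f ->
  exists M, forall x, Omega x -> `|f x| <= M.
Proof.
move=> [M [_ OM]] cf.
have K : compact (closed_ball_ (fun x : V => `|x|) 0 (`|M| + 1)).
  apply: bounded_closed_compact; last exact: closed_closed_ball_.
  exists (`|M| + 1); split; first exact: num_real.
  by move=> c cM x; rewrite /closed_ball_/= sub0r normrN => /le_trans; apply; exact: ltW.
have [B [_ fB]] := compact_bounded
  (continuous_compact (continuous_subspaceT cf) K).
exists (`|B| + 1) => x Ox; apply: (fB (`|B| + 1)).
  by rewrite (le_lt_trans (ler_norm B))// ltrDl.
exists x => //; rewrite /closed_ball_/= sub0r normrN; apply: OM => //.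
by rewrite (le_lt_trans (ler_norm M))// ltrDl.
Qed.

Lemma Lqnorm_oo_le Omega f (e : R) : 0 <= e ->
  (Lqnorm Omega +oo f <= e%:E)%E <-> {ae leb, forall x, Omega x -> `|f x| <= e}.
Proof.
move=> e0.
have aeE : (\forall x \ae leb, (abse \o (EFin \o f) \_ Omega) x <= e%:E)%E <->
    {ae leb, forall x, Omega x -> `|f x| <= e}.
  split; apply: filterS => x; rewrite /= /patch.
    by move=> + Ox; rewrite mem_set.
  case: ifPn => [/set_mem Ox /(_ Ox)|_ _]; first by rewrite lee_fin.
  by rewrite abse0 lee_fin.
rewrite /Lqnorm unlock; case: ifPn => [_|].
  by rewrite -aeE; split => /ess_supP.
(* If the whole space had measure zero, [Lnorm] at [+oo] would be 0 by convention; every property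
   then holds almost everywhere, and both sides are true. *)
rewrite -leNgt lee_fin e0 => leb0; split => // _.
exists setT; split => //; apply/eqP; rewrite eq_le leb0/=; exact: measure_ge0.
Qed.

Lemma continuous_divergence Omega (phi : V -> V) :
  C1c_field Omega phi -> continuous (divergence phi).
Proof.
move=> [phi1 _].
have -> : divergence phi = \sum_i partial i (fun y => phi y ord0 i).
  by rewrite fct_sumE.
elim/big_ind : _ => [|f g cf cg|i _].
- exact: (@cst_continuous _ _ (0 : R)).
- by move=> x; exact: cvgD (cf x) (cg x).
- by have [_ /(_ i)[]] := phi1 i.
Qed.

End rV_borel.

(** * Right continuity of the approximate variation *)

Section eps_variation.
Variables (R : realType) (N : nat) (Omega : set 'rV[R]_N).
Local Notation V := 'rV[R]_N.
Local Notation leb := (lebesgue_rV R N).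
Implicit Types (u v w : V -> R) (phi : V -> V).

Lemma eps_Var_nonincreasing u :
  {homo (fun e => eps_Var Omega e u) : a b / a <= b >-> (b <= a)%E}.
Proof.
move=> a b ab; apply: ereal_inf_le_tmp => _ [v [BVv uv] <-].
by exists v => //; split => //; apply: le_trans uv _; rewrite lee_fin.
Qed.

Hypotheses (oO : open Omega) (bO : bounded_set Omega).

Let mO : measurable Omega. Proof. exact: open_measurable_rV. Qed.

Let leb_lty : (leb Omega < +oo)%E. Proof. exact: bounded_lebesgue_rV_lty. Qed.

Lemma integrable_mul_divergence phi f : C1c_field Omega phi ->
  L1 Omega f -> leb.-integrable Omega (fun x => (f x * divergence phi x)%:E).
Proof.
move=> Cphi If; have cd := continuous_divergence Cphi.
have [M dM] := continuous_bounded_rV bO cd.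
apply: (integrableMl mO If (measurable_funTS (continuous_measurable_rV cd))).
exists M; split; first exact: num_real.
by move=> c Mc x /= /dM /le_trans; apply; exact: ltW.
Qed.

(** The limit is taken for the perturbations [w = v - u]: [u] is only in L^1, while [w] is
    essentially bounded and so square integrable on the bounded set [Omega]. *)
Lemma eps_Var_le_of_gt u (eps0 L : R) : 0 < eps0 -> L1 Omega u ->
  (forall e, eps0 < e -> (eps_Var Omega e u <= L%:E)%E) ->
  (eps_Var Omega eps0 u <= L%:E)%E.
Proof.
move=> eps0_gt0 Iu uL.
pose r n : R := n.+1%:R^-1.
have r0 n : 0 < r n by rewrite invr_gt0.
have r_dec n : r n.+1 <= r n by rewrite lef_pV2 ?posrE// ler_nat.
have r1 n : r n <= 1 by rewrite invf_le1 ?ler1n.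
have cvgr (a : R) : a + r n @[n --> \oo] --> a.
  by rewrite -[X in _ --> X]addr0; apply: cvgD; [exact: cvg_cst|exact: cvg_harmonic].
pose adm phi := C1c_field Omega phi /\ forall x, enorm (phi x) <= 1.
pose E f phi := (\int[leb]_(x in Omega) (f x * divergence phi x)%:E)%E.
(* The bound on the variation is imposed on each test field separately: [E] is affine in [w], which
   gives stability under midpoints, and the limit can be taken field by field. *)
pose K n : set (V -> R) := [set w : V -> R | [/\ measurable_fun Omega w,
  {ae leb, forall x, Omega x -> `|w x| <= eps0 + r n} &
  forall phi, adm phi -> (E (u \+ w)%R phi <= (L + r n)%:E)%E]].
have measu : measurable_fun Omega u by apply/measurable_EFinP; exact: measurable_int Iu.
have IK n w : K n w -> L1 Omega (u \+ w).
  move=> [mw wr _]; apply: eq_integrable (integrableD mO Iu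
    (ae_bounded_integrable mO leb_lty mw wr)) => //.
(* The slack [r n] turns the bound [L] into a strict one, so some competitor [v] of the infimum
   stays below [L + r n]; its perturbation [v - u] is the witness. *)
have K0 n : K n !=set0.
  have : (eps_Var Omega (eps0 + r n) u < (L + r n)%:E)%E.
    apply: (@le_lt_trans _ _ L%:E); first by rewrite uL// ltrDl.
    by rewrite lte_fin ltrDl.
  move=> /ereal_inf_lt[_ [v [[Iv _] uv] <-] vL].
  have mv : measurable_fun Omega v by apply/measurable_EFinP; exact: measurable_int Iv.
  exists (v \- u); split.
  - exact: measurable_funB.
  - have /Lqnorm_oo_le : 0 <= eps0 + r n by rewrite addr_ge0 ?ltW.
    move=> /(_ N Omega (u \- v))[/(_ uv) + _].
    by apply: filterS => x + Ox => /(_ Ox); rewrite distrC.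
  - move=> phi aphi; apply: le_trans (ltW vL).
    have -> : (u \+ (v \- u))%R = v by apply/funext => x /=; rewrite addrC subrK.
    by apply: ereal_sup_ubound; exists phi.
have Kdec n : K n.+1 `<=` K n.
  move=> w [mw wr wL]; split => //.
  - by apply: filterS wr => x + Ox => /(_ Ox) /le_trans; apply; rewrite lerD2l.
  - by move=> phi /wL /le_trans; apply; rewrite lee_fin lerD2l.
have Kmid n f g : K n f -> K n g -> K n (fun x => (f x + g x) / 2).
  move=> Kf Kg; have [mf fr fL] := Kf; have [mg gr gL] := Kg; split.
  - by apply: measurable_funM => //; exact: measurable_funD.
  - apply: filterS2 fr gr => x fC gC Ox; move: (fC Ox) (gC Ox).
    by rewrite !ler_norml => /andP[? ?] /andP[? ?]; apply/andP; split; lra.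
  - move=> phi aphi; have := fL _ aphi; have := gL _ aphi.
    have If := integrable_mul_divergence aphi.1 (IK _ _ Kf).
    have Ig := integrable_mul_divergence aphi.1 (IK _ _ Kg).
    have -> : E (u \+ (fun x => (f x + g x) / 2))%R phi =
        (2^-1%:E * (E (u \+ f)%R phi + E (u \+ g)%R phi))%E.
      rewrite /E -integralD// -integralZl//; last exact: integrableD.
      by apply: eq_integral => x _; rewrite -EFinD -EFinM /=; congr EFin; field.
    have /fin_numP : E (u \+ f)%R phi \is a fin_num := integrable_fin_num mO If.
    have /fin_numP : E (u \+ g)%R phi \is a fin_num := integrable_fin_num mO Ig.
    case: (E _ phi) (E _ phi) => [a||] [b||] //= [? ?] [? ?] //.
    rewrite -EFinD -EFinM !lee_fin; lra.
have KC f : K 0%N f -> measurable_fun Omega f /\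
    {ae leb, forall x, Omega x -> `|f x| <= eps0 + r 0%N} by case.
have [w [v [Kw mv wv]]] := ae_cvg_of_nested_convex mO leb_lty K0 Kdec Kmid KC.
(* One null set serves all [n], so the bounds [eps0 + r n] can be passed to the limit pointwise. *)
have wr : {ae leb, forall x n, Omega x -> `|w n x| <= eps0 + r n}.
  by apply: ae_foralln => n; have [] := Kw n.
have v_eps0 : {ae leb, forall x, Omega x -> `|v x| <= eps0}.
  apply: filterS2 wv wr => x wvx wrx Ox.
  apply: ler_cvg_to (cvg_norm (wvx Ox)) (cvgr eps0) _.
  by apply: nearW => n; exact: wrx.
have Iuv : L1 Omega (u \+ v).
  by apply: eq_integrable (integrableD mO Iu
    (ae_bounded_integrable mO leb_lty mv v_eps0)).
have Var_uv : (Var Omega (u \+ v)%R <= L%:E)%E.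
  apply: ge_ereal_sup => _ [phi aphi <-].
  have cd := continuous_divergence aphi.1.
  have md : measurable_fun Omega (divergence phi).
    exact: measurable_funTS (continuous_measurable_rV cd).
  have [M dM] := continuous_bounded_rV bO cd.
  have Iw n := integrable_mul_divergence aphi.1 (IK _ _ (Kw n)).
  have Iv := integrable_mul_divergence aphi.1 Iuv.
  have I1 : leb.-integrable Omega (EFin \o cst (eps0 + 1)).
    apply: (@ae_bounded_integrable _ _ _ _ _ mO leb_lty _ (eps0 + 1)) => //.
    by apply: nearW => x _; rewrite ger0_norm// addr_ge0 ?ltW.
  (* This dominates all integrands: [|w n| <= eps0 + 1] almost everywhere because [r n <= 1], and
     [M] bounds the divergence on [Omega]. *)
  have Ig : leb.-integrable Omega (fun x => ((`|u x| + (eps0 + 1)) * M)%:E).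
    by apply: eq_integrable (integrableZr mO M
      (integrableD mO (integrable_norm Iu) I1)).
  have [||_ _] := @dominated_convergence _ _ _ leb Omega mO
    (fun n x => ((u \+ w n)%R x * divergence phi x)%:E) _ _
    (fun n => measurable_int _ (Iw n)) (measurable_int _ Iv) _ Ig.
  - apply: filterS wv => x + Ox => /(_ Ox) wvx; apply: cvg_EFin; first exact: nearW.
    apply: cvgM; last exact: cvg_cst.
    by apply: cvgD wvx; exact: cvg_cst.
  - apply: filterS wr => x wrx n Ox; rewrite /= lee_fin normrM.
    rewrite ler_pM// ?dM// (le_trans (ler_normD _ _))// lerD2l.
    by rewrite (le_trans (wrx n Ox))// lerD2l.
  move=> cE.
  have cL : (L + r n)%:E @[n --> \oo] --> L%:E.
    by apply: cvg_EFin; [exact: nearW|exact: cvgr].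
  by apply: lee_cvg_to cE cL _; apply: nearW => n; have [_ _] := Kw n; exact.
apply: le_trans (Var_uv); apply: ereal_inf_lbound; exists (u \+ v) => //.
split; first by split => //; apply: le_lt_trans Var_uv _; exact: ltry.
apply/Lqnorm_oo_le; first exact: ltW.
apply: filterS v_eps0 => x + Ox => /(_ Ox).
by rewrite /= opprD addNKr normrN.
Qed.

End eps_variation.

Theorem proposition3p18 (R : realType) (N : nat) (Omega : set 'rV[R]_N)
    (u : 'rV[R]_N -> R) (eps0 : R) :
  (1 <= N)%N ->
  (N = 1%N -> is_interval [set x : R | Omega (const_mx x)]) ->
  open Omega -> bounded_set Omega -> BV_extension_domain Omega ->
  regulated_oo Omega u -> 0 < eps0 ->
  eps_Var Omega eps u @[eps --> eps0^'+] --> eps_Var Omega eps0 u.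
Proof.
move=> _ _ oO bO _ [Iu _] eps0_gt0.
(* Monotonicity already gives convergence to the supremum [S] of the values to the right of [eps0];
   only its identification remains. *)
have := @nonincreasing_at_right_cvge R (fun e => eps_Var Omega e u) eps0
  +oo%O isT (in2W (@eps_Var_nonincreasing _ _ _ u)).
set S := ereal_sup _.
suff -> : S = eps_Var Omega eps0 u by [].
apply/eqP; rewrite eq_le; apply/andP; split.
  apply: ge_ereal_sup => _ [e + <-]; rewrite /= in_itv/= andbT => /ltW.
  exact: eps_Var_nonincreasing.
have SL (L : R) : (S <= L%:E)%E -> (eps_Var Omega eps0 u <= L%:E)%E.
  move=> SL; apply: eps_Var_le_of_gt => // e e_gt; apply: le_trans SL.
  by apply: ereal_sup_ubound; exists e => //=; rewrite in_itv/= e_gt.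
(* A real [S] is itself an admissible [L], and [+oo] is trivial. If [S] were [-oo], every real would
   bound the value at [eps0]; [x - 1] rules out a real value [x], and 0 rules out [+oo]. *)
case: S SL => [s|_|]; [exact|exact: leey|].
case: (eps_Var Omega eps0 u) => [x|/(_ 0 (leNye _))|//] //.
by move=> /(_ (x - 1) (leNye _)); rewrite lee_fin => ?; exfalso; lra.
Qed.
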